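(* Let $n\ge 1$, $\hbar>0$, and let $\theta=(\theta^{ij})$ be a constant real antisymmetric $n\times n$ matrix. Let $\phi=\phi(x)$ be a complex-valued wave function on $\mathbb{R}^n$, let $h=h(x,p)$ be a real function on $\mathbb{R}^n\times\mathbb{R}^n$, and let $$f(x,p)=\frac{1}{(2\pi)^n}\int d^n w\;\phi(x)*e^{ip\cdot w}*\overline{\phi}(x).$$ If $\phi\to\phi+\delta\phi$ with $\delta\phi=i\,\big(h(x,-i\hbar\frac{\partial}{\partial x})*_\theta\phi\big)$, then the resulting (first-order) variation $$\delta f=\frac{1}{(2\pi)^n}\int d^n w\,\Big[\delta\phi(x)*e^{ip\cdot w}*\overline{\phi}(x)+\phi(x)*e^{ip\cdot w}*\overline{\delta\phi}(x)\Big]$$ satisfies $$\delta f=i\,[h,f]=i\,(h*f-f*h).$$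
   Context: No particular function class is fixed for $\phi$ and $h$: they are functions for which the Fourier representations, star products and integrals written here are meaningful, and the identity is a formal one obtained by Fourier superposition of exponentials. Notation: $k\cdot x=\sum_i k_i x^i$, $\theta(k,k')=\sum_{i,j}\theta^{ij}k_ik'_j$, overline is complex conjugation. For $A$ on $\mathbb{R}^{2n}$, $\tilde A(k,l)=\int d^nx\,d^np\, e^{-ik\cdot x-il\cdot p}A(x,p)$; for $B$ on $\mathbb{R}^n$, $\tilde B(k)=\int d^nx\, e^{-ik\cdot x}B(x)$. Star product: on exponentials $$e^{ik\cdot x+il\cdot p} * e^{ik'\cdot x+il'\cdot p}=e^{-\frac{i\hbar}{2}(k\cdot l'-k'\cdot l)}\,e^{-\frac{i}{2}\theta(k,k')}\,e^{i(k+k')\cdot x+i(l+l')\cdot p},$$ extended bilinearly by Fourier superposition; the product is associative. The product $*_\theta$ is obtained from $*$ by setting $\hbar=0$. For functions $u,v$ of $x$ only and $w\in\mathbb{R}^n$, $u(x)*e^{ip\cdot w}*v(x)=e^{ip\cdot w}\,\big(u(x-\tfrac{\hbar}{2}w)*_\theta v(x+\tfrac{\hbar}{2}w)\big)$, with $*_\theta$ taken in $x$ at fixed $w$. Weyl-ordered operator: $$h(x,-i\hbar\tfrac{\partial}{\partial x})*_\theta \phi(x)=\frac{1}{(2\pi)^{3n}}\int \tilde h(k,l)\tilde \phi(k')\,e^{i\hbar\, l\cdot(k'+\frac12 k)}\,e^{-\frac i2\theta(k,k')}\,e^{i(k+k')\cdot x}\,d^nk\,d^nl\,d^nk',$$ i.e.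 the Fourier superposition of $e^{ik\cdot x+il\cdot(-i\hbar\partial_x)}*_\theta e^{ik'\cdot x}$ with $e^{ik\cdot x+\hbar l\cdot\partial_x}=e^{ik\cdot x}e^{\frac{i\hbar}{2}k\cdot l}e^{\hbar l\cdot\partial_x}$. *)

(* Defs.v *)
From HB Require Import structures.
From mathcomp Require Import all_boot all_order all_algebra.
From mathcomp Require Import complex.
From mathcomp Require Import all_classical all_reals all_analysis.

Set Implicit Arguments.
Unset Strict Implicit.
Unset Printing Implicit Defensive.

Import Order.TTheory GRing.Theory Num.Theory.
Local Open Scope classical_set_scope.
Local Open Scope ring_scope.

(* [m1 \x m2] has no usable canonical sigma-finite structure for general
   sigma-finite factors (the instance for subprobabilities takes precedence),
   hence this alias, which is convertible to [m1 \x m2]. *)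
Section sigma_finite_product.
Context d1 d2 (T1 : measurableType d1) (T2 : measurableType d2) (R : realType).
Variable m1 : {sigma_finite_measure set T1 -> \bar R}.
Variable m2 : {sigma_finite_measure set T2 -> \bar R}.

Definition sfprod : set (T1 * T2) -> \bar R := (m1 \x m2)%E.

HB.instance Definition _ := Measure.copy sfprod (m1 \x m2)%E.

Lemma sfprod_sigma_finite : sigma_finite setT sfprod.
Proof.
have /sigma_finiteP[F [TF ndF Foo]] := sigma_finiteT m1.
have /sigma_finiteP[G [TG ndG Goo]] := sigma_finiteT m2.
exists (fun n => F n `*` G n).
 rewrite -setXTT TF TG predeqE => -[x y]; split.
    move=> [/= [n _ Fnx] [k _ Gky]]; exists (maxn n k) => //; split.
    - by move: x Fnx; exact/subsetPset/ndF/leq_maxl.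
    - by move: y Gky; exact/subsetPset/ndG/leq_maxr.
  by move=> [n _ []/= ? ?]; split; exists n.
move=> k; have [? ?] := Foo k; have [? ?] := Goo k.
split; first exact: measurableX.
by rewrite /sfprod product_measure1E// lte_mul_pinfty// ge0_fin_numE.
Qed.

HB.instance Definition _ := Measure_isSigmaFinite.Build _ _ _ sfprod
  sfprod_sigma_finite.

End sigma_finite_product.

Definition Rn (R : realType) (n : nat) := n.-tuple (measurableTypeR R).

Section lebesgue_Rn.
Context {R : realType}.

Definition Rn_cons n (z : measurableTypeR R * Rn R n) : Rn R n.+1 :=
  [tuple of z.1 :: z.2].

Lemma measurable_Rn_cons n : measurable_fun setT (@Rn_cons n).
Proof. exact: measurable_cons. Qed.

Section step.
Variables (n : nat) (m : {sigma_finite_measure set (Rn R n) -> \bar R}).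

Definition leb_step : set (Rn R n.+1) -> \bar R :=
  pushforward (sfprod (@lebesgue_measure R) m) (@Rn_cons n).

Let leb_step0 : leb_step set0 = 0%E.
Proof. by rewrite /leb_step /pushforward preimage_set0 measure0. Qed.

Let leb_step_ge0 A : (0 <= leb_step A)%E.
Proof. by rewrite /leb_step /pushforward; exact: measure_ge0. Qed.

Let leb_step_sigma_additive : semi_sigma_additive leb_step.
Proof.
move=> F mF tF mUF; rewrite /leb_step /pushforward preimage_bigcup.
have mT (A : set (Rn R n.+1)) : measurable A ->
    measurable (@Rn_cons n @^-1` A).
  by move=> mA; rewrite -[X in measurable X]setTI; exact: measurable_Rn_cons.
apply: measure_semi_sigma_additive.
- by move=> k; exact: mT.
- apply/trivIsetP => /= i j _ _ ij; rewrite -preimage_setI.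
  by move/trivIsetP : tF => /(_ _ _ _ _ ij) ->//; rewrite preimage_set0.
- by rewrite -preimage_bigcup; exact: mT.
Qed.

HB.instance Definition _ := isMeasure.Build _ _ _ leb_step
  leb_step0 leb_step_ge0 leb_step_sigma_additive.

Let leb_step_sigma_finite : sigma_finite setT leb_step.
Proof.
have [F TF Foo] := sigma_finiteT (sfprod (@lebesgue_measure R) m).
pose g (t : Rn R n.+1) : measurableTypeR R * Rn R n :=
  (tnth t ord0, [tuple of behead t]).
have mg : measurable_fun setT g.
  apply/measurable_fun_pairP; split; first exact: measurable_tnth.
  exact: measurable_behead.
have gK z : g (Rn_cons z) = z.
  by case: z => a t; rewrite /g /Rn_cons /=; congr (_, _); exact/val_inj.
exists (fun k => g @^-1` F k).
  by rewrite -preimage_bigcup -TF preimage_setT.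
move=> k; have [mF Fk] := Foo k; split.
  by rewrite -[X in measurable X]setTI; exact: mg.
rewrite /leb_step /pushforward -comp_preimage.
by rewrite (_ : g \o @Rn_cons n = id)//; apply/funext => z /=; rewrite gK.
Qed.

HB.instance Definition _ := Measure_isSigmaFinite.Build _ _ _ leb_step
  leb_step_sigma_finite.
End step.

Fixpoint leb (n : nat) : {sigma_finite_measure set (Rn R n) -> \bar R} :=
  match n with
  | 0 => \d_([tuple] : Rn R 0)
  | k.+1 => leb_step (leb k)
  end.

End lebesgue_Rn.

Section complex_integral.
Context {R : realType}.

Definition expi (t : R) : R[i] := (cos t +i* sin t)%C.

Context d (T : measurableType d) (mu : {measure set T -> \bar R}).

Definition cintegrable (f : T -> R[i]) : Prop :=
  mu.-integrable setT (fun x => (complex.Re (f x))%:E) /\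
  mu.-integrable setT (fun x => (complex.Im (f x))%:E).

Definition cint (f : T -> R[i]) : R[i] :=
  (\int[mu]_x complex.Re (f x) +i* \int[mu]_x complex.Im (f x))%C.

End complex_integral.

Section star_product.
Context {R : realType} {n : nat}.

Local Notation V := (Rn R n).
Local Notation W := (Rn R n * Rn R n)%type.
Local Notation C := (R[i]).
Local Notation leb1 := (leb n : {sigma_finite_measure set V -> \bar R}).
Local Notation leb2 :=
  (sfprod (leb n) (leb n) : {sigma_finite_measure set W -> \bar R}).

Definition vadd (x y : V) : V :=
  [tuple (tnth x i : R) + (tnth y i : R) | i < n].
Definition vzero : V := [tuple (0 : R) | i < n].
Definition dot (k x : V) : R := \sum_(i < n) (tnth k i : R) * (tnth x i : R).
Definition thetaf (theta : 'M[R]_n) (k k' : V) : R :=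
  \sum_(i < n) \sum_(j < n) theta i j * (tnth k i : R) * (tnth k' j : R).

Definition inv2pi (m : nat) : C := (((2 * pi) ^+ m)^-1)%:C%C.

Definition fourier1 (B : V -> C) (k : V) : C :=
  cint leb1 (fun x => expi (- dot k x) * B x).
Definition fourier2 (A : W -> C) (xi : W) : C :=
  cint leb2 (fun z => expi (- dot xi.1 z.1 - dot xi.2 z.2) * A z).

(* Functions with a pointwise, absolutely convergent Fourier representation. *)
Definition fourier_rep1 (B : V -> C) : Prop :=
  [/\ cintegrable leb1 B, cintegrable leb1 (fourier1 B) &
      forall x, B x = inv2pi n *
        cint leb1 (fun k => fourier1 B k * expi (dot k x))].
Definition fourier_rep2 (A : W -> C) : Prop :=
  [/\ cintegrable leb2 A, cintegrable leb2 (fourier2 A) &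
      forall z, A z = inv2pi (2 * n)%N *
        cint leb2 (fun xi => fourier2 A xi *
                             expi (dot xi.1 z.1 + dot xi.2 z.2))].

(* (c, (k, l)) stands for the plane wave c e^(i k.x + i l.p). *)
Definition wave := (C * W)%type.
Definition weval (a : wave) (z : W) : C :=
  a.1 * expi (dot a.2.1 z.1 + dot a.2.2 z.2).

Variables (hbar : R) (theta : 'M[R]_n).

Definition wstar (a b : wave) : wave :=
  (a.1 * b.1
     * expi (- (hbar / 2) * (dot a.2.1 b.2.2 - dot b.2.1 a.2.2))
     * expi (- (1 / 2) * thetaf theta a.2.1 b.2.1),
   (vadd a.2.1 b.2.1, vadd a.2.2 b.2.2)).

(* The extension of wstar by Fourier superposition, A * B. *)
Definition star (A B : W -> C) (z : W) : C :=
  inv2pi (4 * n)%N *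
  cint (sfprod leb2 leb2) (fun q : W * W =>
    weval (wstar (fourier2 A q.1, q.1) (fourier2 B q.2, q.2)) z).

(* u(x) * e^(i p.w) * v(x): none of the factors decays in p, so u and v are
   superposed from the waves e^(i k.x) through their Fourier transforms in x
   alone, and e^(i p.w) is itself a wave. *)
Definition star_exp (u : V -> C) (w : V) (v : V -> C) (z : W) : C :=
  inv2pi (2 * n)%N *
  cint leb2 (fun q : V * V =>
    weval (wstar (wstar (fourier1 u q.1, (q.1, vzero)) (1, (vzero, w)))
                 (fourier1 v q.2, (q.2, vzero))) z).

Definition fdist (phi : V -> C) (z : W) : C :=
  inv2pi n *
  cint leb1 (fun w => star_exp phi w (fun x => (phi x)^*%C) z).

Definition fdist_var (phi dphi : V -> C) (z : W) : C :=
  inv2pi n *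
  cint leb1 (fun w => star_exp dphi w (fun x => (phi x)^*%C) z +
                      star_exp phi w (fun x => (dphi x)^*%C) z).

(* h(x, - i hbar d/dx) *_theta phi; the integration variable is ((k, l), k'). *)
Definition weyl_star (h : W -> C) (phi : V -> C) (x : V) : C :=
  inv2pi (3 * n)%N *
  cint (sfprod leb2 leb1) (fun q : W * V =>
    fourier2 h q.1 * fourier1 phi q.2
    * expi (hbar * (dot q.1.2 q.2 + dot q.1.2 q.1.1 / 2))
    * expi (- (1 / 2) * thetaf theta q.1.1 q.2)
    * expi (dot (vadd q.1.1 q.2) x)).

End star_product.

(* Main.v *)
(* Write s(k,l) = hbar l + theta k / 2, where theta k is the vector with
   components sum_j theta^{ij} k_j.  Fourier inversion in one factor turns the
   plane-wave rule into phase-space shifts: h * f at (x, p) is the integral of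
   h~(k,l) e^(i k.x + i l.p) f(x + hbar l / 2 + theta k / 2, p - hbar k / 2), and
   the Weyl operator applied to phi is the integral of
   h~(k,l) e^(i k.x) e^(i hbar k.l / 2) phi(x + s(k,l)).  Likewise
   u * e^(i p.w) * v, integrated over w, becomes an absolutely convergent integral
   of v~(k') u(x - hbar w / 2 - theta k' / 2) times a phase over (w, k').  Putting
   the Weyl operator in the slot u, exchanging the integrals and translating w by
   l gives exactly h * f.  Complex conjugation reverses star products, and f and h
   are real, so the second term of the variation is the conjugate of the first. *)

Require Import Defs.
From mathcomp Require Import all_boot all_order all_algebra.
From mathcomp Require Import complex.
From mathcomp Require Import all_classical all_reals all_analysis.
From mathcomp Require Import measurable_realfun.
From mathcomp Require Import ring lra.

Set Implicit Arguments.
Unset Strict Implicit.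
Unset Printing Implicit Defensive.

Import Order.TTheory GRing.Theory Num.Theory.
Import numFieldNormedType.Exports.
Local Open Scope classical_set_scope.
Local Open Scope ring_scope.

(** * Complex-valued integrals *)

Section expi_theory.
Context {R : realType}.
Implicit Types (a b t : R) (u v : R[i]).

Lemma ReM u v :
  complex.Re (u * v) = complex.Re u * complex.Re v - complex.Im u * complex.Im v.
Proof. by case: u v => [? ?] [? ?]. Qed.

Lemma ImM u v :
  complex.Im (u * v) = complex.Re u * complex.Im v + complex.Im u * complex.Re v.
Proof. by case: u v => [? ?] [? ?]. Qed.

Lemma expiD a b : expi (a + b) = expi a * expi b.
Proof.
apply/eqP; rewrite eq_complex ReM ImM /= cosD sinD eqxx /=.
by rewrite [X in _ == X]addrC.
Qed.

Lemma expi0 : expi 0 = 1 :> R[i].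
Proof. by rewrite /expi cos0 sin0. Qed.

Lemma conj_expi t : (expi t)^*%C = expi (- t).
Proof. by rewrite /expi cosN sinN. Qed.

Lemma conjcM u v : (u * v)^*%C = u^*%C * v^*%C.
Proof. exact: rmorphM. Qed.

Lemma conj_inv2pi m : (inv2pi m : R[i])^*%C = inv2pi m.
Proof. exact: conjc_real. Qed.

Lemma inv2piD m1 m2 : inv2pi (m1 + m2) = inv2pi m1 * inv2pi m2 :> R[i].
Proof. by rewrite /inv2pi exprD invfM rmorphM. Qed.

End expi_theory.

Section cintegral.
Context {R : realType} d (T : measurableType d) (mu : {measure set T -> \bar R}).
Implicit Types (f g : T -> R[i]) (c : R[i]) (t : T -> R).

(** Both components of the product are sums of an integrable function times a measurable function
    bounded by 1 ([cos] or [sin] of [t]). Integrability of an oscillating integrand thus reduces to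
    that of its amplitude. *)
Lemma cintegrable_phase f t : measurable_fun setT t ->
  cintegrable mu f -> cintegrable mu (fun x => f x * expi (t x)).
Proof.
move=> mt [fr fi].
have B (g h : T -> R) : mu.-integrable setT (EFin \o g) ->
    measurable_fun setT h -> (forall x, `|h x| <= 1) ->
    mu.-integrable setT (EFin \o (fun x => g x * h x)).
  move=> ig mh h1; have /measurable_EFinP mg := measurable_int _ ig.
  apply: le_integrable ig => //.
    by apply/measurable_EFinP; exact: measurable_funM.
  by move=> x _ /=; rewrite lee_fin normrM ler_piMr.
have mc : measurable_fun setT (fun x => cos (t x)).
  apply: measurableT_comp mt; apply: continuous_measurable_fun.
  exact: continuous_cos.
have ms : measurable_fun setT (fun x => sin (t x)).
  apply: measurableT_comp mt; apply: continuous_measurable_fun.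
  exact: continuous_sin.
have c1 x : `|cos (t x)| <= 1 by rewrite ler_norml cos_geN1 cos_le1.
have s1 x : `|sin (t x)| <= 1 by rewrite ler_norml sin_geN1 sin_le1.
split; under eq_fun do rewrite ?ReM ?ImM /= ?EFinB ?EFinD.
- apply: integrableB => //; exact: B.
- by apply: integrableD => //; exact: B.
Qed.

Lemma cintegrableZ c f : cintegrable mu f -> cintegrable mu (fun x => c * f x).
Proof.
move=> [fr fi]; split; under eq_fun do rewrite ?ReM ?ImM ?EFinB ?EFinD !EFinM.
- by apply: integrableB => //; exact: integrableZl.
- by apply: integrableD => //; exact: integrableZl.
Qed.

Lemma cintZ c f : cintegrable mu f -> cint mu (fun x => c * f x) = c * cint mu f.
Proof.
move=> [fr fi]; rewrite /cint.
have Z (r : R) (g : T -> R) : mu.-integrable setT (EFin \o g) ->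
   mu.-integrable setT (EFin \o (fun x => r * g x)) by exact: integrableZl.
under eq_Rintegral do rewrite ReM.
under [X in (_ +i* X)%C]eq_Rintegral do rewrite ImM.
rewrite RintegralB ?RintegralD ?RintegralZl //; [|exact: Z..].
by apply/eqP; rewrite eq_complex ReM ImM /= !eqxx.
Qed.

Lemma cintD f g : cintegrable mu f -> cintegrable mu g ->
  cint mu (fun x => f x + g x) = cint mu f + cint mu g.
Proof.
move=> [fr fi] [gr gi].
have ReD u v : complex.Re (u + v) = complex.Re u + complex.Re v :> R.
  by case: u v => [? ?] [? ?].
have ImD u v : complex.Im (u + v) = complex.Im u + complex.Im v :> R.
  by case: u v => [? ?] [? ?].
rewrite /cint; under eq_Rintegral do rewrite ReD.
under [X in (_ +i* X)%C]eq_Rintegral do rewrite ImD.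
by rewrite !RintegralD.
Qed.

Lemma Re_conj (u : R[i]) : complex.Re (u^*)%C = complex.Re u.
Proof. by case: u. Qed.

Lemma Im_conj (u : R[i]) : complex.Im (u^*)%C = - complex.Im u.
Proof. by case: u. Qed.

Lemma cintegrable_conj f :
  cintegrable mu f -> cintegrable mu (fun x => (f x)^*%C).
Proof.
move=> [fr fi]; split; first by under eq_fun do rewrite Re_conj.
by under eq_fun do rewrite Im_conj EFinN; exact: (integrableN fi).
Qed.

Lemma cint_conj f : cintegrable mu f ->
  cint mu (fun x => (f x)^*%C) = (cint mu f)^*%C.
Proof.
move=> [fr fi]; rewrite /cint.
under eq_Rintegral do rewrite Re_conj.
under [X in (_ +i* X)%C]eq_Rintegral do rewrite Im_conj -mulN1r.
by rewrite RintegralZl // mulN1r.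
Qed.

Lemma eq_cint f g : f =1 g -> cint mu f = cint mu g.
Proof. by move=> /funext ->. Qed.

Lemma eq_cintegrable f g : f =1 g -> cintegrable mu f -> cintegrable mu g.
Proof. by move=> /funext ->. Qed.

End cintegral.

(** * Fubini's theorem for complex-valued integrals *)

Section fubini.
Context {R : realType} d1 d2 (T1 : measurableType d1) (T2 : measurableType d2).
Variable m1 : {sigma_finite_measure set T1 -> \bar R}.
Variable m2 : {sigma_finite_measure set T2 -> \bar R}.

(** For real factors, Tonelli splits the integral of the modulus into a product of two finite
    integrals; the complex case is a combination of four real ones. *)
Lemma cintegrable_tensor (f : T1 -> R[i]) (g : T2 -> R[i]) :
  cintegrable m1 f -> cintegrable m2 g ->
  cintegrable (sfprod m1 m2) (fun q => f q.1 * g q.2).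
Proof.
move=> [fr fi] [gr gi].
have mN d (T : measurableType d) (k : T -> R) :
    measurable_fun setT (EFin \o k) -> measurable_fun setT (fun x => `|k x|%:E).
  by move=> mk; apply/measurable_EFinP/measurableT_comp => //; exact/measurable_EFinP.
have B (a : T1 -> R) (b : T2 -> R) : m1.-integrable setT (EFin \o a) ->
    m2.-integrable setT (EFin \o b) ->
    (sfprod m1 m2).-integrable setT (EFin \o (fun q => a q.1 * b q.2)).
  move=> ia ib; have [ma la] := integrableP _ _ _ ia.
  have [mb lb] := integrableP _ _ _ ib.
  apply/integrable12ltyP.
    apply/measurable_EFinP; apply: measurable_funM.
      by apply: measurableT_comp => //; exact/measurable_EFinP.
    by apply: measurableT_comp => //; exact/measurable_EFinP.
  under eq_integral => x _.
    under eq_integral => y _ do rewrite /= normrM EFinM.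
    rewrite ge0_integralZl //; last exact: mN.
    over.
  rewrite ge0_integralZr //=; last 2 first.
  - exact: mN.
  - exact: integral_ge0.
  apply: lte_mul_pinfty => //; first exact: integral_ge0.
  by rewrite ge0_fin_numE //; exact: integral_ge0.
split; under eq_fun do rewrite ?ReM ?ImM ?EFinB ?EFinD.
- by apply: integrableB => //; [exact: (B _ _ fr gr)|exact: (B _ _ fi gi)].
- by apply: integrableD => //; [exact: (B _ _ fr gi)|exact: (B _ _ fi gr)].
Qed.

Variable f : T1 * T2 -> R[i].
Hypothesis intf : cintegrable (sfprod m1 m2) f.

(* [\int[m2]_y g (x, y)] is the junk value [0] where [g (x, _)] is not
   integrable, which may only happen on a negligible set. *)
Let F1 (g : T1 * T2 -> R) : (sfprod m1 m2).-integrable setT (EFin \o g) ->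
  m1.-integrable setT (fun x => (\int[m2]_y g (x, y))%:E) /\
  \int[m1]_x \int[m2]_y g (x, y) = \int[sfprod m1 m2]_q g q.
Proof.
move=> ig.
have mF := measurable_fubini_F ig.
have mG : measurable_fun setT (fun x => (\int[m2]_y g (x, y))%:E).
  by apply/measurable_EFinP; exact: measurableT_comp mF.
have FG : ae_eq m1 setT (fun x => (\int[m2]_y g (x, y))%:E)
    (fubini_F m2 (EFin \o g)).
  have := ae_integrable1 ig; apply: filterS => x ix _.
  by rewrite /fubini_F /Rintegral fineK //; exact: integrable_fin_num.
split.
  apply/integrableP; split=> //.
  have /integrableP[_] := integrable_fubini_F ig.
  rewrite (ae_eq_integral (abse \o (fubini_F m2 (EFin \o g)))
    (abse \o (fun x => (\int[m2]_y g (x, y))%:E))) //.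
  - exact: measurableT_comp.
  - exact: measurableT_comp.
  - by apply: filterS FG => x E /E {}E; rewrite /= -E.
rewrite [LHS]/Rintegral (ae_eq_integral _ _ _ _ _ FG) //.
by rewrite (integral12_prod_meas1 ig).
Qed.

Let F2 (g : T1 * T2 -> R) : (sfprod m1 m2).-integrable setT (EFin \o g) ->
  m2.-integrable setT (fun y => (\int[m1]_x g (x, y))%:E) /\
  \int[m2]_y \int[m1]_x g (x, y) = \int[sfprod m1 m2]_q g q.
Proof.
move=> ig.
have mF := measurable_fubini_G ig.
have mG : measurable_fun setT (fun y => (\int[m1]_x g (x, y))%:E).
  by apply/measurable_EFinP; exact: measurableT_comp mF.
have FG : ae_eq m2 setT (fun y => (\int[m1]_x g (x, y))%:E)
    (fubini_G m1 (EFin \o g)).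
  have := ae_integrable2 ig; apply: filterS => x ix _.
  by rewrite /fubini_G /Rintegral fineK //; exact: integrable_fin_num.
split.
  apply/integrableP; split=> //.
  (* The modulus of the inner integral is at most the inner integral of the modulus, whose integral
     over the second variable is finite. *)
  have iG : m2.-integrable setT (fubini_G m1 (EFin \o g)).
    have /integrableP[mg _] := ig; apply/integrableP; split=> //.
    have := (integrable21ltyP m1 m2 mg).1 ig; apply: le_lt_trans.
    apply: ge0_le_integral => //.
    - exact: measurableT_comp.
    - apply: (measurable_fun_fubini_tonelli_G (abse \o (EFin \o g))).
        exact: measurableT_comp.
      by move=> q /=.
    - move=> y _; apply: le_abse_integral => //.
      exact: measurable_fun_pair1.
  have /integrableP[_] := iG.
  rewrite (ae_eq_integral (abse \o (fubini_G m1 (EFin \o g)))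
    (abse \o (fun y => (\int[m1]_x g (x, y))%:E))) //.
  - exact: measurableT_comp.
  - exact: measurableT_comp.
  - by apply: filterS FG => x E /E {}E; rewrite /= -E.
rewrite [LHS]/Rintegral (ae_eq_integral _ _ _ _ _ FG) //.
by rewrite (integral21_prod_meas1 ig).
Qed.

Lemma cintegrable_cint1 :
  cintegrable m1 (fun x => cint m2 (fun y => f (x, y))).
Proof. by case: intf => /F1[? _] /F1[? _]; split. Qed.

Lemma cintegrable_cint2 :
  cintegrable m2 (fun y => cint m1 (fun x => f (x, y))).
Proof. by case: intf => /F2[? _] /F2[? _]; split. Qed.

Lemma cint_prod1 :
  cint (sfprod m1 m2) f = cint m1 (fun x => cint m2 (fun y => f (x, y))).
Proof.
by case: intf => /F1[_ Er] /F1[_ Ei]; rewrite /cint /= -Er -Ei.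
Qed.

Lemma cint_prod2 :
  cint (sfprod m1 m2) f = cint m2 (fun y => cint m1 (fun x => f (x, y))).
Proof.
by case: intf => /F2[_ Er] /F2[_ Ei]; rewrite /cint /= -Er -Ei.
Qed.

End fubini.

(** * Changes of variables *)

Section transports.
Context {R : realType}.

(** The push-forward of [mu] by [T] is [c] times [nu], tested on non-negative functions; [c] is an
    inverse Jacobian. In this form substitutions compose and pass through Tonelli directly. *)
Definition transports d1 d2 (T1 : measurableType d1) (T2 : measurableType d2)
    (mu : {measure set T1 -> \bar R}) (nu : {measure set T2 -> \bar R})
    (T : T1 -> T2) (c : R) : Prop :=
  [/\ measurable_fun setT T, 0 <= c &
      forall f : T2 -> \bar R, measurable_fun setT f -> (forall x, 0 <= f x)%E ->
        (\int[mu]_x f (T x) = c%:E * \int[nu]_y f y)%E].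

Lemma transports_comp d1 d2 d3 (T1 : measurableType d1)
    (T2 : measurableType d2) (T3 : measurableType d3)
    (m1 : {measure set T1 -> \bar R}) (m2 : {measure set T2 -> \bar R})
    (m3 : {measure set T3 -> \bar R}) (S : T1 -> T2) (T : T2 -> T3) (b c : R) :
  transports m1 m2 S b -> transports m2 m3 T c ->
  transports m1 m3 (T \o S) (b * c).
Proof.
move=> [mS b0 ES] [mT c0 ET]; split; [exact: measurableT_comp|exact: mulr_ge0|].
move=> f mf f0; rewrite EFinM -muleA -ET // -(ES (f \o T)) //.
  exact: measurableT_comp.
by move=> x /=.
Qed.

Section cint_transports.
Context d1 d2 (T1 : measurableType d1) (T2 : measurableType d2).
Context (mu : {measure set T1 -> \bar R}) (nu : {measure set T2 -> \bar R}).
Variables (T : T1 -> T2) (c : R).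
Hypothesis tT : transports mu nu T c.

Let integrable_T (f : T2 -> R) : nu.-integrable setT (EFin \o f) ->
  mu.-integrable setT (EFin \o (f \o T)).
Proof.
case: tT => mT c0 ET /integrableP[mf foo]; apply/integrableP; split.
  exact: (measurableT_comp mf).
rewrite (ET (abse \o (EFin \o f))) /=; last 2 first.
- exact: measurableT_comp.
- by move=> x /=.
by apply: lte_mul_pinfty => //; rewrite lee_fin.
Qed.

Let integral_T (f : T2 -> R) : nu.-integrable setT (EFin \o f) ->
  \int[mu]_x f (T x) = c * \int[nu]_y f y.
Proof.
case: tT => mT c0 ET intf; rewrite /Rintegral.
have [mf _] := integrableP _ _ _ intf.
have fp := integrable_funepos measurableT intf.
have fn := integrable_funeneg measurableT intf.
(* Positive and negative parts are transported separately; both integrals over [nu] are finite, so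
   the difference distributes. *)
have E : (\int[mu]_x (f (T x))%:E = c%:E * \int[nu]_y (f y)%:E)%E.
  rewrite integralE (integralE nu) muleBr //; last first.
    by rewrite fin_num_adde_defl// fin_numN; exact: integrable_fin_num.
  congr (_ - _)%E.
    under eq_integral do
      rewrite -[(fun x => (f (T x))%:E)]/((EFin \o f) \o T) funepos_comp.
    by rewrite (ET (EFin \o f)^\+%E)//; exact: measurable_funepos.
  under eq_integral do
    rewrite -[(fun x => (f (T x))%:E)]/((EFin \o f) \o T) funeneg_comp.
  by rewrite (ET (EFin \o f)^\-%E)//; exact: measurable_funeneg.
by rewrite E fineM//; exact: integrable_fin_num.
Qed.

Lemma cintegrable_comp f : cintegrable nu f -> cintegrable mu (f \o T).
Proof. by move=> [/integrable_T ? /integrable_T ?]; split. Qed.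

Lemma cint_comp f : cintegrable nu f -> cint mu (f \o T) = c%:C%C * cint nu f.
Proof.
move=> [/integral_T Er /integral_T Ei]; rewrite /cint /= Er Ei.
by apply/eqP; rewrite eq_complex /= !mul0r addr0 subr0 !eqxx.
Qed.

End cint_transports.

Lemma cint_comp1 d1 d2 (T1 : measurableType d1) (T2 : measurableType d2)
    (mu : {measure set T1 -> \bar R}) (nu : {measure set T2 -> \bar R}) T f :
  transports mu nu T 1 -> cintegrable nu f -> cint mu (f \o T) = cint nu f.
Proof. by move=> tT intf; rewrite (cint_comp tT intf) mul1r. Qed.

Section tonelli.
Context d1 d2 (T1 : measurableType d1) (T2 : measurableType d2).
Variable m1 : {sigma_finite_measure set T1 -> \bar R}.
Variable m2 : {sigma_finite_measure set T2 -> \bar R}.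
Variable f : T1 * T2 -> \bar R.
Hypotheses (mf : measurable_fun setT f) (f0 : forall q, (0 <= f q)%E).

Lemma sfprod_tonelli1 :
  (\int[sfprod m1 m2]_q f q = \int[m1]_x \int[m2]_y f (x, y))%E.
Proof. exact: (fubini_tonelli1 f mf f0). Qed.

Lemma sfprod_tonelli2 :
  (\int[sfprod m1 m2]_q f q = \int[m2]_y \int[m1]_x f (x, y))%E.
Proof. by rewrite sfprod_tonelli1; exact: (fubini_tonelli f mf f0). Qed.

End tonelli.

(** * Substitutions on product spaces *)

Section product.
Context d1 d2 d3 (T1 : measurableType d1) (T2 : measurableType d2)
  (T3 : measurableType d3).
Variable m1 : {sigma_finite_measure set T1 -> \bar R}.
Variable m2 : {sigma_finite_measure set T2 -> \bar R}.
Variable m3 : {sigma_finite_measure set T3 -> \bar R}.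

(** Tonelli integrates over the first variable with [y] frozen, where the fibrewise substitution
    applies with the same [c]. This covers translations by an amount that depends on [y]. *)
Lemma transports_shear (T : T1 * T2 -> T3) c :
  0 <= c -> measurable_fun setT T ->
  (forall y, transports m1 m3 (fun x => T (x, y)) c) ->
  transports (sfprod m1 m2) (sfprod m3 m2) (fun q => (T q, q.2)) c.
Proof.
move=> c0 mT H; have mS : measurable_fun setT (fun q : T1 * T2 => (T q, q.2)).
  exact: measurable_fun_pair.
split=> // f mf f0.
rewrite (sfprod_tonelli2 m1 m2 (f := fun q => f (T q, q.2))) //=; last first.
  exact: measurableT_comp mf mS.
transitivity (\int[m2]_y (c%:E * \int[m3]_x f (x, y)))%E.
  apply: eq_integral => y _; have [_ _ /(_ (fun x => f (x, y))) ->] := H y => //.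
  exact: measurable_fun_pair1.
rewrite ge0_integralZl //.
- congr (_ * _)%E; symmetry; exact: sfprod_tonelli2.
- exact: (measurable_fun_fubini_tonelli_G f).
- by move=> y _; exact: integral_ge0.
Qed.

Lemma transports_swap :
  transports (sfprod m1 m2) (sfprod m2 m1) (fun q => (q.2, q.1)) 1.
Proof.
have mS : measurable_fun setT (fun q : T1 * T2 => (q.2, q.1)).
  exact: measurable_fun_pair.
split=> // f mf f0; rewrite mul1e.
rewrite (sfprod_tonelli1 m1 m2 (f := fun q => f (q.2, q.1))) //=; last first.
  exact: measurableT_comp mf mS.
by symmetry; exact: sfprod_tonelli2.
Qed.

End product.

(** Apply [S] to the first coordinate, swap, apply [T] to what is now the first coordinate, and swap
    back. *)
Lemma transports_prod d1 d2 d3 d4 (T1 : measurableType d1)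
    (T2 : measurableType d2) (T3 : measurableType d3) (T4 : measurableType d4)
    (m1 : {sigma_finite_measure set T1 -> \bar R})
    (m2 : {sigma_finite_measure set T2 -> \bar R})
    (m3 : {sigma_finite_measure set T3 -> \bar R})
    (m4 : {sigma_finite_measure set T4 -> \bar R}) S T b c :
  transports m1 m3 S b -> transports m2 m4 T c ->
  transports (sfprod m1 m2) (sfprod m3 m4) (fun q => (S q.1, T q.2)) (b * c).
Proof.
move=> tS tT; have [mS b0 _] := tS; have [mT c0 _] := tT.
have S1 : transports (sfprod m1 m2) (sfprod m3 m2) (fun q => (S q.1, q.2)) b.
  by apply: transports_shear => //; exact: measurableT_comp.
have T1' : transports (sfprod m2 m3) (sfprod m4 m3) (fun q => (T q.1, q.2)) c.
  by apply: transports_shear => //; exact: measurableT_comp.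
have := transports_comp (transports_comp S1 (transports_swap _ _))
  (transports_comp T1' (transports_swap _ _)).
by rewrite !mulr1.
Qed.

End transports.

(** * Affine substitutions on the real line *)

Section lebesgue.
Context {R : realType}.
Local Notation leb1 := (@lebesgue_measure R).

Lemma transports_opp : transports leb1 leb1 (fun x : R => - x) 1.
Proof.
pose N (x : measurableTypeR R) : measurableTypeR R := - x.
have mN : measurable_fun setT N by exact: oppr_measurable.
split=> // f mf f0; rewrite mul1e.
have := ge0_integral_pushforward (phi := N) mN leb1
  measurableT mf (fun y _ => f0 y).
rewrite preimage_setT /= => <-.
by apply: eq_measure_integral => A mA _; exact: lebesgue_measureN.
Qed.

(** The preimage of an interval has its length divided by [a], so [a] times the push-forward agrees
    with Lebesgue measure on intervals, hence everywhere by uniqueness. *)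
Lemma transports_affine_gt0 (a b : R) : 0 < a ->
  transports leb1 leb1 (fun x : R => a * x + b) a^-1.
Proof.
move=> a0.
pose T (x : measurableTypeR R) : measurableTypeR R := a * x + b.
have mT : measurable_fun setT T.
  by apply: measurable_funD => //; exact: measurable_funM.
split=> //; first by rewrite invr_ge0 ltW.
move=> f mf f0.
have E A : measurable A ->
    leb1 A = mscale (NngNum (ltW a0)) (pushforward leb1 T) A.
  apply: lebesgue_measure_unique => //= _ [[u v]] _ <-.
  have TP : T @^-1` `]u, v] = `](u - b) / a, (v - b) / a]%classic.
    apply/seteqP; split=> x /=; rewrite !in_itv /= ltr_pdivrMr // ler_pdivlMr //;
      rewrite /T mulrC; lra.
  transitivity (a%:E * leb1 (T @^-1` `]u, v]))%E; last by [].
  rewrite TP !lebesgue_measure_itv /= !lte_fin ltr_pM2r ?invr_gt0 // ltrD2r.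
  case: ifP => _; last by rewrite mule0.
  rewrite -!EFinB -EFinM; congr EFin; field.
  by rewrite gt_eqF.
have := ge0_integral_pushforward (phi := T) mT leb1 measurableT mf (fun y _ => f0 y).
rewrite preimage_setT /= => <-.
rewrite [in RHS](eq_measure_integral
    (mscale (NngNum (ltW a0)) (pushforward leb1 T))); last first.
  by move=> A mA _; exact: E.
by rewrite ge0_integral_mscale //= muleA -EFinM mulVf ?mul1e // gt_eqF.
Qed.

Lemma transports_affine (a b : R) : a != 0 ->
  transports leb1 leb1 (fun x : R => a * x + b) `|a|^-1.
Proof.
move=> a0; have [a_gt0|a_le0] := ltP 0 a.
  by rewrite gtr0_norm //; exact: transports_affine_gt0.
have a_lt0 : a < 0 by rewrite lt_neqAle a0.
have := transports_comp transports_opp (transports_affine_gt0 b (_ : 0 < - a)).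
rewrite oppr_gt0 => /(_ a_lt0); rewrite mul1r ltr0_norm //.
by congr transports; apply/funext => x /=; rewrite mulrNN.
Qed.

End lebesgue.

(** * Vector operations and the form [theta] *)

Section vectors.
Context {R : realType} {n : nat}.
Implicit Types (x y k l w : Rn R n) (a b : R) (theta : 'M[R]_n).

Definition vscale a x : Rn R n := [tuple a * (tnth x i : R) | i < n].

Definition vlin theta x : Rn R n :=
  [tuple \sum_(j < n) theta i j * (tnth x j : R) | i < n].

Lemma vaddE x y i : tnth (vadd x y) i = (tnth x i : R) + (tnth y i : R).
Proof. by rewrite tnth_mktuple. Qed.

Lemma vscaleE a x i : tnth (vscale a x) i = a * (tnth x i : R).
Proof. by rewrite tnth_mktuple. Qed.

Lemma vlinE theta x i :
  tnth (vlin theta x) i = \sum_(j < n) theta i j * (tnth x j : R).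
Proof. by rewrite tnth_mktuple. Qed.

Lemma vzeroE i : tnth (vzero : Rn R n) i = 0 :> R.
Proof. by rewrite tnth_mktuple. Qed.

Lemma vlinZ theta a x : vlin theta (vscale a x) = vscale a (vlin theta x).
Proof.
apply: eq_from_tnth => i; rewrite vscaleE !vlinE mulr_sumr.
by apply: eq_bigr => j _; rewrite vscaleE mulrCA.
Qed.

Lemma dotC x y : dot x y = dot y x.
Proof. by apply: eq_bigr => i _; rewrite mulrC. Qed.

Lemma dotDr k x y : dot k (vadd x y) = dot k x + dot k y.
Proof. by rewrite -big_split /=; apply: eq_bigr => i _; rewrite vaddE mulrDr. Qed.

Lemma dotDl x y k : dot (vadd x y) k = dot x k + dot y k.
Proof. by rewrite dotC dotDr !(dotC k). Qed.

Lemma dotZr k a x : dot k (vscale a x) = a * dot k x.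
Proof. by rewrite mulr_sumr; apply: eq_bigr => i _; rewrite vscaleE mulrCA. Qed.

Lemma dotZl a x k : dot (vscale a x) k = a * dot x k.
Proof. by rewrite dotC dotZr (dotC k). Qed.

Definition dotE := (dotDl, dotDr, dotZl, dotZr).

Lemma dot0r k : dot k vzero = 0.
Proof. by apply: big1 => i _; rewrite vzeroE mulr0. Qed.

Lemma thetafE theta k l : thetaf theta k l = dot k (vlin theta l).
Proof.
apply: eq_bigr => i _; rewrite vlinE mulr_sumr.
by apply: eq_bigr => j _; rewrite -mulrA mulrCA.
Qed.

(** All uses of the antisymmetry of [theta] below go through this exchange of the two wave
    vectors. *)
Lemma dot_vlinC theta k l : theta^T = - theta ->
  dot k (vlin theta l) = - dot l (vlin theta k).
Proof.
move=> skew; rewrite -!thetafE /thetaf exchange_big /= -sumrN.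
apply: eq_bigr => i _; rewrite -sumrN; apply: eq_bigr => j _.
by have /matrixP/(_ i j) := skew; rewrite !mxE => ->; ring.
Qed.

End vectors.

(** * Measurability of the vector operations *)

Section measurable_vectors.
Context {R : realType} {n : nat} d (T : measurableType d).
Implicit Types (f g : T -> Rn R n).

Lemma measurable_coord f i : measurable_fun setT f ->
  measurable_fun setT (fun t => tnth (f t) i : R).
Proof. by move=> /measurable_fun_tnthP /(_ i). Qed.

Lemma measurable_vadd f g : measurable_fun setT f -> measurable_fun setT g ->
  measurable_fun setT (fun t => vadd (f t) (g t)).
Proof.
move=> mf mg; apply/measurable_fun_tnthP => i /=.
rewrite /comp; under eq_fun do rewrite vaddE.
by apply: measurable_funD; exact: measurable_coord.
Qed.

Lemma measurable_vscale a f : measurable_fun setT f ->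
  measurable_fun setT (fun t => vscale a (f t)).
Proof.
move=> mf; apply/measurable_fun_tnthP => i /=.
rewrite /comp; under eq_fun do rewrite vscaleE.
by apply: measurable_funM => //; exact: measurable_coord.
Qed.

Lemma measurable_vlin (theta : 'M[R]_n) f : measurable_fun setT f ->
  measurable_fun setT (fun t => vlin theta (f t)).
Proof.
move=> mf; apply/measurable_fun_tnthP => i /=.
rewrite /comp; under eq_fun do rewrite vlinE.
apply: measurable_sum => j.
by apply: measurable_funM => //; exact: measurable_coord.
Qed.

Lemma measurable_dot f g : measurable_fun setT f -> measurable_fun setT g ->
  measurable_fun setT (fun t => dot (f t) (g t)).
Proof.
move=> mf mg; rewrite /dot; apply: measurable_sum => i.
by apply: measurable_funM; exact: measurable_coord.
Qed.

End measurable_vectors.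

(** * Affine substitutions in n dimensions *)

Section lebesgue_Rn_affine.
Context {R : realType}.

Lemma measurable_affine n (a : R) (b : Rn R n) :
  measurable_fun setT (fun w : Rn R n => vadd (vscale a w) b).
Proof.
apply: measurable_vadd => //.
exact: (measurable_vscale a (@measurable_id _ (Rn R n) setT)).
Qed.

(** Induction on [n]: [leb n.+1] is the push-forward of a product under [Rn_cons], and the map acts
    coordinatewise, so the scalar case on the head combines with the induction hypothesis on the
    tail. In dimension 0 there is only one point. *)
Lemma transports_leb n (a : R) (b : Rn R n) : a != 0 ->
  transports (leb n) (leb n) (fun w => vadd (vscale a w) b) (`|a|^-1 ^+ n).
Proof.
move=> a0; elim: n b => [|n IH] b.
  rewrite expr0; split=> //; first exact: measurable_affine.
  move=> f mf f0; rewrite mul1e; apply: eq_integral => x _.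
  by congr f; apply: eq_from_tnth => -[].
split; [exact: measurable_affine|by rewrite exprn_ge0 // invr_ge0|].
move=> f mf f0 /=.
have push (g : Rn R n.+1 -> \bar R) : measurable_fun setT g ->
    (forall x, 0 <= g x)%E ->
    (\int[leb_step (leb n)]_x g x =
     \int[sfprod (@lebesgue_measure R) (leb n)]_z g (Rn_cons z))%E.
  move=> mg g0.
  have := ge0_integral_pushforward (@measurable_Rn_cons R n)
    (sfprod (@lebesgue_measure R) (leb n)) measurableT mg (fun y _ => g0 y).
  by rewrite preimage_setT.
rewrite !push //; last exact: measurableT_comp mf (measurable_affine _ _).
have [_ _ E] := transports_prod (transports_affine (tnth b ord0) a0)
  (IH [tuple of behead b]).
rewrite exprS -E //; last first.
  exact: measurableT_comp mf (@measurable_Rn_cons R n).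
apply: eq_integral => -[z t] _; congr f; apply: eq_from_tnth => i.
rewrite vaddE vscaleE /=.
have [->|i0] := eqVneq i ord0; first by [].
have i1n : (i.-1 < n)%N by rewrite prednK ?lt0n// -ltnS.
have -> : i = lift ord0 (Ordinal i1n).
  by apply/val_inj => /=; rewrite /bump/= add1n prednK// lt0n.
rewrite !tnthS vaddE vscaleE tnth_behead; congr (_ + tnth b _).
by apply/val_inj; rewrite /= inordK.
Qed.

Lemma transports_shift n (b : Rn R n) :
  transports (leb n) (leb n) (fun w => vadd w b) 1.
Proof.
have := @transports_leb n 1 b (oner_neq0 _).
rewrite normr1 invr1 expr1n; congr transports; apply/funext => w.
by apply: eq_from_tnth => i; rewrite !vaddE vscaleE mul1r.
Qed.

Lemma transports_reflect n : transports (leb n) (leb n) (@vscale R n (-1)) 1.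
Proof.
have := @transports_leb n (-1) vzero; rewrite oppr_eq0 oner_eq0 => /(_ isT).
rewrite normrN1 invr1 expr1n; congr transports; apply/funext => w.
by apply: eq_from_tnth => i; rewrite vaddE vzeroE addr0.
Qed.

End lebesgue_Rn_affine.

(** * Star products and the Wigner transform *)

Ltac phase_of T e :=
  lazymatch e with
  | ?x * ?y => let a := phase_of T x in let b := phase_of T y in constr:(a + b)
  | expi ?t => constr:(t)
  | _ => constr:(0 : T)
  end.

Ltac modulus_of e :=
  lazymatch e with
  | ?x * ?y => let a := modulus_of x in let b := modulus_of y in constr:(a * b)
  | @expi ?T _ => constr:(1 : complex T)
  | ?x => constr:(x)
  end.

(* Reduces an equality between products of complex factors and phases to the
   equality of the total phases. *)
Ltac merge_phases :=
  lazymatch goal with |- ?L = ?R =>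
    let T := lazymatch L with context [@expi ?T _] => T end in
    let a := phase_of T L in let b := phase_of T R in let m := modulus_of L in
    let E := fresh "E" in
    have E : a = b; [|
      transitivity (m * expi a);
        [rewrite ?expiD ?expi0; ring | rewrite E ?expiD ?expi0; ring]]
  end.

Ltac measurability := repeat lazymatch goal with
  | |- measurable_fun _ (fun t => dot (@?f t) (@?g t)) => apply: measurable_dot
  | |- measurable_fun _ (fun t => vadd (@?f t) (@?g t)) => apply: measurable_vadd
  | |- measurable_fun _ (fun t => vscale _ (@?f t)) => apply: measurable_vscale
  | |- measurable_fun _ (vscale _) => apply: measurable_vscale
  | |- measurable_fun _ (fun t => vlin _ (@?f t)) => apply: measurable_vlin
  | |- measurable_fun _ (vlin _) => apply: measurable_vlin
  | |- measurable_fun _ (dot _) => apply: measurable_dot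
  | |- measurable_fun _ (vadd _) => apply: measurable_vadd
  | |- measurable_fun _ (fun t => (@?f t, @?g t)) => apply: measurable_fun_pair
  | |- measurable_fun _ (fun t => @?f t - @?g t) => apply: measurable_funB
  | |- measurable_fun _ (fun t => @?f t + @?g t) => apply: measurable_funD
  | |- measurable_fun _ (fun t => @?f t * @?g t) => apply: measurable_funM
  | |- measurable_fun _ (fun t => - @?f t) => apply: measurable_funN
  | |- measurable_fun _ fst => exact: measurable_fst
  | |- measurable_fun _ snd => exact: measurable_snd
  | |- measurable_fun _ (fun t => fst t) => exact: measurable_fst
  | |- measurable_fun _ (fun t => snd t) => exact: measurable_snd
  | |- measurable_fun _ (fun t => fst (@?f t)) =>
      apply: (@measurableT_comp _ _ _ _ _ _ fst)
  | |- measurable_fun _ (fun t => snd (@?f t)) =>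
      apply: (@measurableT_comp _ _ _ _ _ _ snd)
  | |- measurable_fun _ (fun t => t) => exact: measurable_id
  | |- measurable_fun _ id => exact: measurable_id
  | |- measurable_fun _ (fun t => ?c) => exact: measurable_cst
  end.

(** * Integrability of products of translated functions *)

Section translates.
Context {R : realType} {n : nat} d (T : measurableType d).
Variable m : {sigma_finite_measure set T -> \bar R}.
Variable a : R.
Hypothesis a0 : a != 0.
Local Notation V := (Rn R n).
Local Notation C := (R[i]).

Lemma transports_translates (s : T -> V) : measurable_fun setT s ->
  transports (sfprod (leb n) m) (sfprod (leb n) m)
    (fun q => (vadd (vscale a q.1) (s q.2), q.2)) (`|a|^-1 ^+ n).
Proof.
move=> ms; apply: transports_shear.
- by rewrite exprn_ge0 // invr_ge0.
- measurability; exact: measurableT_comp.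
- by move=> y /=; exact: transports_leb.
Qed.

(** The shear by [s] carries the tensor product of [u] and [g] to this integrand. It supplies the
    joint integrability that later exchanges of integrals require. *)
Lemma cintegrable_translates (u : V -> C) (g : T -> C) (s : T -> V) :
  measurable_fun setT s -> cintegrable (leb n) u -> cintegrable m g ->
  cintegrable (sfprod (leb n) m)
    (fun q => u (vadd (vscale a q.1) (s q.2)) * g q.2).
Proof.
move=> ms iu ig.
exact: (cintegrable_comp (transports_translates ms) (cintegrable_tensor iu ig)).
Qed.

End translates.

Section translates2.
Context {R : realType} {n : nat} d (T : measurableType d).
Variable m : {sigma_finite_measure set T -> \bar R}.
Variable a : R.
Hypothesis a0 : a != 0.
Local Notation V := (Rn R n).
Local Notation C := (R[i]).

(** With the last variable frozen, the substitution is the shear of [transports_translates] in the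
    first two; [transports_shear] then assembles the fibres. *)
Lemma cintegrable_translates2 (u v : V -> C) (g : T -> C) (s : V * T -> V) :
  measurable_fun setT s ->
  cintegrable (leb n) u -> cintegrable (leb n) v -> cintegrable m g ->
  cintegrable (sfprod (sfprod (leb n) (leb n)) m)
    (fun q => u (vadd (vscale a q.1.1) (s (q.1.2, q.2))) * v q.1.2 * g q.2).
Proof.
move=> ms iu iv ig.
have tS : transports (sfprod (sfprod (leb n) (leb n)) m)
    (sfprod (sfprod (leb n) (leb n)) m)
    (fun q => ((vadd (vscale a q.1.1) (s (q.1.2, q.2)), q.1.2), q.2))
    (`|a|^-1 ^+ n).
  apply: transports_shear.
  - by rewrite exprn_ge0 // invr_ge0.
  - measurability; apply: (measurableT_comp ms); measurability.
  - move=> y /=.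
    apply: (transports_translates (leb n) a0 (s := fun x => s (x, y))).
    exact: measurable_fun_pair1.
exact: (cintegrable_comp tS (cintegrable_tensor (cintegrable_tensor iu iv) ig)).
Qed.

End translates2.

Section star_product_theory.
Context {R : realType} {n : nat}.
Local Notation V := (Rn R n).
Local Notation W := (Rn R n * Rn R n)%type.
Local Notation C := (R[i]).
Local Notation leb1 := (leb n : {sigma_finite_measure set V -> \bar R}).
Local Notation leb2 :=
  (sfprod (leb n) (leb n) : {sigma_finite_measure set W -> \bar R}).

Variables (hbar : R) (theta : 'M[R]_n).
Hypothesis hbar0 : 0 < hbar.
Hypothesis skew : theta^T = - theta.

(** * The product [u * e^(i p.w) * v] and its integral over [w] *)

Lemma thetaf0r (k : V) : thetaf theta k vzero = 0.
Proof.
by apply: big1 => i _; apply: big1 => j _; rewrite vzeroE mulr0.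
Qed.

Lemma vadd0r (k : V) : vadd k vzero = k.
Proof. by apply: eq_from_tnth => i; rewrite vaddE vzeroE addr0. Qed.

Lemma vadd0l (k : V) : vadd vzero k = k.
Proof. by apply: eq_from_tnth => i; rewrite vaddE vzeroE add0r. Qed.

(** The last bracket of the phase collects what is linear in [q.1], the wave vector of [u], ready
    for Fourier inversion. *)
Lemma star_expE (u v : V -> C) w z :
  star_exp hbar theta u w v z = inv2pi (2 * n)%N *
  cint leb2 (fun q => fourier1 u q.1 * fourier1 v q.2 *
    expi (dot w z.2 + dot q.2 z.1 + hbar / 2 * dot q.2 w +
      (dot q.1 z.1 - hbar / 2 * dot q.1 w - 1 / 2 * dot q.1 (vlin theta q.2)))).
Proof.
congr (_ * _); apply: eq_cint => q.
rewrite /weval /wstar /= !vadd0r !vadd0l !dot0r !dotDl thetaf0r thetafE.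
merge_phases; ring.
Qed.

(** The point where [u] is evaluated: [e^(i p.w)] shifts it by [- hbar w / 2], and the wave
    [e^(i k.x)] of [v] by [- theta k / 2]. *)
Definition wigner_arg (x w k : V) : V :=
  vadd (vadd x (vscale (- (hbar / 2)) w)) (vscale (- (1 / 2)) (vlin theta k)).

Lemma fourier_rep1E (u : V -> C) x : fourier_rep1 u ->
  inv2pi n * cint leb1 (fun k => fourier1 u k * expi (dot k x)) = u x.
Proof. by case. Qed.

Lemma cintegrable_wave (u : V -> C) x : fourier_rep1 u ->
  cintegrable leb1 (fun k => fourier1 u k * expi (dot k x)).
Proof.
by case=> _ iu _; apply: cintegrable_phase => //; measurability.
Qed.

(* The integrand of the Wigner transform over [q = (w, k)], [k] dual to the
   argument of [v], once [u] has been recovered by Fourier inversion. *)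
Definition wigner_kernel (u v : V -> C) (z : W) (q : V * V) : C :=
  fourier1 v q.2 * expi (dot q.1 z.2 + dot q.2 z.1 + hbar / 2 * dot q.2 q.1) *
  u (wigner_arg z.1 q.1 q.2).

(** Integrating first over the wave vector of [u] is Fourier inversion at [wigner_arg]. *)
Lemma star_exp_kernel (u v : V -> C) w z :
  fourier_rep1 u -> cintegrable leb1 (fourier1 v) ->
  star_exp hbar theta u w v z =
  inv2pi n * cint leb1 (fun k => wigner_kernel u v z (w, k)).
Proof.
move=> ru iv; have [_ iu _] := ru.
have iF : cintegrable leb2 (fun q => fourier1 u q.1 * fourier1 v q.2 *
    expi (dot w z.2 + dot q.2 z.1 + hbar / 2 * dot q.2 w +
      (dot q.1 z.1 - hbar / 2 * dot q.1 w - 1 / 2 * dot q.1 (vlin theta q.2)))).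
  apply: cintegrable_phase; last exact: cintegrable_tensor.
  by measurability.
rewrite star_expE mul2n -addnn inv2piD -mulrA; congr (_ * _).
rewrite (cint_prod2 iF) -cintZ; last exact: (cintegrable_cint2 iF).
apply: eq_cint => k /=.
rewrite /wigner_kernel -(fourier_rep1E _ ru) mulrCA; congr (_ * _).
rewrite -cintZ; last exact: cintegrable_wave.
apply: eq_cint => l; rewrite /wigner_arg.
merge_phases; rewrite !dotE; ring.
Qed.

(** The integrand of [star_exp] has a modulus independent of [w]. Once [u] is recovered, decay in
    [w] comes from [u] itself, whose argument has slope [- hbar / 2] in [w]; this is nonzero because
    [0 < hbar]. *)
Lemma cintegrable_wigner (u v : V -> C) z :
  cintegrable leb1 u -> cintegrable leb1 (fourier1 v) ->
  cintegrable leb2 (wigner_kernel u v z).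
Proof.
move=> iu iv.
pose s k := vadd z.1 (vscale (- (1 / 2)) (vlin theta k)).
have ms : measurable_fun setT s by rewrite /s; measurability.
have a0 : - (hbar / 2) != 0 by rewrite oppr_eq0 mulf_neq0 // gt_eqF.
have := cintegrable_translates a0 ms iu iv.
move=> /(cintegrable_phase (t := fun q : V * V =>
  dot q.1 z.2 + dot q.2 z.1 + hbar / 2 * dot q.2 q.1)) I.
apply: eq_cintegrable (I _); last by measurability.
move=> q; rewrite /wigner_kernel.
rewrite (_ : vadd _ (s q.2) = wigner_arg z.1 q.1 q.2); first by ring.
by apply: eq_from_tnth => i; rewrite !vaddE; ring.
Qed.

(** Two-slot form of [fdist], which is the case where [v] is the conjugate of [u]. Each term of the
    variation alters one slot. *)
Definition wigner (u v : V -> C) z : C :=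
  inv2pi n * cint leb1 (fun w => star_exp hbar theta u w v z).

Section wigner.
Variables (u v : V -> C).
Hypotheses (ru : fourier_rep1 u) (iv : cintegrable leb1 (fourier1 v)).

Let iu : cintegrable leb1 u. Proof. by case: ru. Qed.

Lemma cintegrable_star_exp z :
  cintegrable leb1 (fun w => star_exp hbar theta u w v z).
Proof.
under eq_fun do rewrite star_exp_kernel //.
exact/cintegrableZ/cintegrable_cint1/cintegrable_wigner.
Qed.

Lemma wignerE z :
  wigner u v z = inv2pi (2 * n)%N * cint leb2 (wigner_kernel u v z).
Proof.
rewrite /wigner; under eq_fun do rewrite star_exp_kernel //.
have iw := cintegrable_wigner z iu iv.
rewrite cintZ; last exact: (cintegrable_cint1 iw).
by rewrite mulrA -inv2piD addnn -mul2n -(cint_prod1 iw).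
Qed.

End wigner.

(** * The star product as a phase-space shift *)

Lemma fourier_rep2E (B : W -> C) z : fourier_rep2 B ->
  inv2pi (2 * n)%N *
  cint leb2 (fun q => fourier2 B q * expi (dot q.1 z.1 + dot q.2 z.2)) = B z.
Proof. by case. Qed.

Lemma cintegrable_wave2 (B : W -> C) z : fourier_rep2 B ->
  cintegrable leb2 (fun q => fourier2 B q * expi (dot q.1 z.1 + dot q.2 z.2)).
Proof.
by case=> _ iB _; apply: cintegrable_phase => //; measurability.
Qed.

(** The Bopp shift of the phase-space point [z] caused by the wave [q] of the left factor. *)
Definition star_arg (z q : W) : W :=
  (vadd (vadd z.1 (vscale (hbar / 2) q.2)) (vscale (1 / 2) (vlin theta q.1)),
   vadd z.2 (vscale (- (hbar / 2)) q.1)).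

Definition star_phase (z : W) (q : W * W) : R :=
  dot q.1.1 z.1 + dot q.1.2 z.2 +
  (dot q.2.1 (star_arg z q.1).1 + dot q.2.2 (star_arg z q.1).2).

(** The twist of the plane-wave rule is absorbed into the argument of the second wave. Antisymmetry
    turns [- k.theta k' / 2] into [k'.theta k / 2], the theta shift of [star_arg]. *)
Lemma starE (A B : W -> C) z : star hbar theta A B z = inv2pi (4 * n)%N *
  cint (sfprod leb2 leb2) (fun q =>
    fourier2 A q.1 * fourier2 B q.2 * expi (star_phase z q)).
Proof.
congr (_ * _); apply: eq_cint => q.
rewrite /weval /wstar /star_phase /star_arg /=.
merge_phases; rewrite !dotE thetafE (dot_vlinC _ _ skew).
rewrite (dotC q.1.1 q.2.2); ring.
Qed.

Lemma cintegrable_star (A B : W -> C) z :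
  cintegrable leb2 (fourier2 A) -> cintegrable leb2 (fourier2 B) ->
  cintegrable (sfprod leb2 leb2) (fun q =>
    fourier2 A q.1 * fourier2 B q.2 * expi (star_phase z q)).
Proof.
move=> iA iB; apply: cintegrable_phase; last exact: cintegrable_tensor.
rewrite /star_phase /star_arg /=; measurability.
Qed.

Lemma star_shift (A B : W -> C) z :
  cintegrable leb2 (fourier2 A) -> fourier_rep2 B ->
  star hbar theta A B z = inv2pi (2 * n)%N *
  cint leb2 (fun q => fourier2 A q *
    expi (dot q.1 z.1 + dot q.2 z.2) * B (star_arg z q)).
Proof.
move=> iA rB; have [_ iB _] := rB.
have iF := cintegrable_star z iA iB.
rewrite starE (_ : (4 * n = 2 * n + 2 * n)%N); last by rewrite -mulnDl.
rewrite inv2piD -mulrA; congr (_ * _).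
rewrite (cint_prod1 iF) -cintZ; last exact: (cintegrable_cint1 iF).
apply: eq_cint => q /=.
rewrite -(fourier_rep2E _ rB) mulrCA; congr (_ * _).
rewrite -cintZ; last exact: cintegrable_wave2.
apply: eq_cint => l; merge_phases; rewrite /star_phase /=; ring.
Qed.

Lemma cintegrable_fourier_kernel (u : V -> C) k : cintegrable leb1 u ->
  cintegrable leb1 (fun x => expi (- dot k x) * u x).
Proof.
move=> iu; apply: (@eq_cintegrable _ _ _ _ (fun x => u x * expi (- dot k x))).
  by move=> x; rewrite mulrC.
by apply: cintegrable_phase => //; measurability.
Qed.

(** * The Weyl operator and its Fourier representation *)

Section weyl.
Variables (h : W -> C) (phi : V -> C).
Hypotheses (ih : cintegrable leb2 (fourier2 h)) (rphi : fourier_rep1 phi).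

Let iphi : cintegrable leb1 phi. Proof. by case: rphi. Qed.
Let ifphi : cintegrable leb1 (fourier1 phi). Proof. by case: rphi. Qed.

Definition weyl_shift (q : W) : V :=
  vadd (vscale hbar q.2) (vscale (1 / 2) (vlin theta q.1)).

Definition weyl_kernel (x : V) (q : W) : C :=
  fourier2 h q * expi (dot q.1 x + hbar / 2 * dot q.2 q.1) *
  phi (vadd x (weyl_shift q)).

(** The integrand of [weyl_star] with its phase regrouped: the part linear in [q.2] inverts the
    Fourier transform of [phi] at the shifted point. *)
Let F x (q : W * V) : C := fourier2 h q.1 * fourier1 phi q.2 *
  expi (dot q.1.1 x + hbar / 2 * dot q.1.2 q.1.1 +
        dot q.2 (vadd x (weyl_shift q.1))).

Let iF x : cintegrable (sfprod leb2 leb1) (F x).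
Proof.
apply: cintegrable_phase; last exact: cintegrable_tensor.
by rewrite /weyl_shift; measurability.
Qed.

Let kernelE x q : weyl_kernel x q = inv2pi n * cint leb1 (fun k => F x (q, k)).
Proof.
rewrite /weyl_kernel -(fourier_rep1E _ rphi) mulrCA; congr (_ * _).
rewrite -cintZ; last exact: cintegrable_wave.
by apply: eq_cint => l; rewrite /F; merge_phases; rewrite /=; ring.
Qed.

Lemma cintegrable_weyl_kernel x : cintegrable leb2 (weyl_kernel x).
Proof.
apply: (eq_cintegrable (fun q => esym (kernelE x q))).
exact/cintegrableZ/(cintegrable_cint1 (iF x)).
Qed.

Lemma weyl_starE x : weyl_star hbar theta h phi x =
  inv2pi (2 * n)%N * cint leb2 (weyl_kernel x).
Proof.
rewrite (eq_cint _ (kernelE x)) cintZ; last exact: (cintegrable_cint1 (iF x)).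
rewrite mulrA -inv2piD (_ : (2 * n + n = 3 * n)%N); last by rewrite mulSn addnC.
rewrite -(cint_prod1 (iF x)); congr (_ * _); apply: eq_cint => q.
rewrite /F /weyl_shift; merge_phases.
by rewrite thetafE !dotE (dot_vlinC _ _ skew) (dotC q.2 q.1.2); field.
Qed.

Lemma cintegrable_weyl_kernel2 :
  cintegrable (sfprod leb1 leb2) (fun q => weyl_kernel q.1 q.2).
Proof.
have ms : measurable_fun setT weyl_shift by rewrite /weyl_shift; measurability.
have := cintegrable_translates (oner_neq0 R) ms iphi ih.
move=> /(cintegrable_phase (t := fun q : V * W =>
  dot q.2.1 q.1 + hbar / 2 * dot q.2.2 q.2.1)) I.
apply: eq_cintegrable (I _); last by measurability.
move=> q; rewrite /weyl_kernel (_ : vscale 1 q.1 = q.1); first by ring.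
by apply: eq_from_tnth => i; rewrite vscaleE mul1r.
Qed.

Lemma cintegrable_weyl_star : cintegrable leb1 (weyl_star hbar theta h phi).
Proof.
apply: (eq_cintegrable (fun x => esym (weyl_starE x))).
exact/cintegrableZ/(cintegrable_cint1 cintegrable_weyl_kernel2).
Qed.

Let sub (k : V) (q : W) : V := vadd k (vscale (-1) q.1).

(** The Fourier transform in [x] of [weyl_kernel x q]: the factor [e^(i q.1.x)] lowers the frequency
    [k] by [q.1], and the translation of [phi] becomes a phase. *)
Let kernelF (k : V) (q : W) : C :=
  fourier2 h q * expi (hbar / 2 * dot q.2 q.1 + dot (sub k q) (weyl_shift q)) *
  fourier1 phi (sub k q).

Let G k (q : V * W) : C := weyl_kernel q.1 q.2 * expi (- dot k q.1).

Let iG k : cintegrable (sfprod leb1 leb2) (G k).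
Proof.
by apply: cintegrable_phase cintegrable_weyl_kernel2; rewrite /=; measurability.
Qed.

Let kernelFE k q : kernelF k q = cint leb1 (fun x => G k (x, q)).
Proof.
have ik := cintegrable_fourier_kernel (sub k q) iphi.
have := cint_comp1 (transports_shift (weyl_shift q)) ik.
move=> E; rewrite /kernelF /fourier1 -E.
rewrite -cintZ; last exact: (cintegrable_comp (transports_shift _) ik).
apply: eq_cint => x; rewrite /G /weyl_kernel /=.
by merge_phases; rewrite /sub !dotE; ring.
Qed.

Lemma fourier_weyl_star k : fourier1 (weyl_star hbar theta h phi) k =
  inv2pi (2 * n)%N * cint leb2 (kernelF k).
Proof.
rewrite (eq_cint _ (kernelFE k)) -(cint_prod2 (iG k)) (cint_prod1 (iG k)).
rewrite -cintZ; last exact: (cintegrable_cint1 (iG k)).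
apply: eq_cint => x; rewrite weyl_starE mulrCA; congr (_ * _).
rewrite -cintZ; last exact: cintegrable_weyl_kernel.
by apply: eq_cint => q; rewrite mulrC.
Qed.

Let ikernelF2 : cintegrable (sfprod leb1 leb2) (fun q => kernelF q.1 q.2).
Proof.
have ms : measurable_fun setT (fun q : W => vscale (-1 : R) q.1) by measurability.
have := cintegrable_translates (oner_neq0 R) ms ifphi ih.
move=> /(cintegrable_phase (t := fun q : V * W =>
  hbar / 2 * dot q.2.2 q.2.1 + dot (sub q.1 q.2) (weyl_shift q.2))) I.
apply: eq_cintegrable (I _); last first.
  by rewrite /sub /weyl_shift; measurability.
move=> q; rewrite /kernelF (_ : vscale 1 q.1 = q.1); first by rewrite /sub; ring.
by apply: eq_from_tnth => i; rewrite vscaleE mul1r.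
Qed.

(** Needed to place the Weyl operator in the slot [u] of [star_exp_kernel]. Its inversion formula is
    inherited from that of [phi], by exchanging integrals and shifting the frequency. *)
Lemma fourier_rep1_weyl_star : fourier_rep1 (weyl_star hbar theta h phi).
Proof.
split; first exact: cintegrable_weyl_star.
  apply: (eq_cintegrable (fun k => esym (fourier_weyl_star k))).
  exact/cintegrableZ/(cintegrable_cint1 ikernelF2).
move=> x; have iK : cintegrable (sfprod leb1 leb2)
    (fun q => kernelF q.1 q.2 * expi (dot q.1 x)).
  by apply: cintegrable_phase ikernelF2; measurability.
transitivity (inv2pi n * (inv2pi (2 * n)%N * cint leb1 (fun k => cint leb2
    (fun q => kernelF k q * expi (dot k x))))); last first.
  congr (_ * _); rewrite -cintZ; last exact: (cintegrable_cint1 iK).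
  apply: eq_cint => k; rewrite fourier_weyl_star -mulrA; congr (_ * _).
  rewrite [RHS]mulrC -cintZ; last first.
    apply: (eq_cintegrable (fun q => esym (kernelFE k q))).
    exact: (cintegrable_cint2 (iG k)).
  by apply: eq_cint => q; rewrite mulrC.
rewrite -(cint_prod1 iK) (cint_prod2 iK) weyl_starE mulrCA; congr (_ * _).
rewrite -cintZ; last exact: (cintegrable_cint2 iK).
apply: eq_cint => q /=.
rewrite /weyl_kernel -(fourier_rep1E _ rphi) mulrCA; congr (_ * _).
have ik := cintegrable_wave (vadd x (weyl_shift q)) rphi.
(* Replacing [k] by [k - q.1] in the inversion integral of [phi] produces the argument [sub k q] of
   [kernelF]. *)
have tk := transports_shift (vscale (-1) q.1).
rewrite -(cint_comp1 tk ik).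
rewrite -cintZ; last exact: (cintegrable_comp tk ik).
apply: eq_cint => k; rewrite /kernelF /sub /=.
by merge_phases; rewrite !dotE; ring.
Qed.

End weyl.

(** * Complex conjugation reverses star products *)

Lemma vscaleN1K (x : V) : vscale (-1) (vscale (-1) x) = x.
Proof. by apply: eq_from_tnth => i; rewrite !vscaleE; ring. Qed.

Lemma fourier1_conj (u : V -> C) k : cintegrable leb1 u ->
  fourier1 (fun x => (u x)^*%C) k = (fourier1 u (vscale (-1) k))^*%C.
Proof.
move=> iu; rewrite -cint_conj; last exact: cintegrable_fourier_kernel.
apply: eq_cint => x; rewrite conjcM conj_expi dotZl; congr (expi _ * _); ring.
Qed.

Lemma cintegrable_fourier1_conj (u : V -> C) : cintegrable leb1 u ->
  cintegrable leb1 (fourier1 u) ->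
  cintegrable leb1 (fourier1 (fun x => (u x)^*%C)).
Proof.
move=> iu iU; apply: (eq_cintegrable (fun k => esym (fourier1_conj k iu))).
exact: cintegrable_conj (cintegrable_comp (transports_reflect n) iU).
Qed.

Lemma fourier_rep1_conj (u : V -> C) :
  fourier_rep1 u -> fourier_rep1 (fun x => (u x)^*%C).
Proof.
move=> ru; have [iu iU _] := ru.
split; [exact: cintegrable_conj|exact: cintegrable_fourier1_conj|].
move=> x; rewrite -(fourier_rep1E x ru) conjcM conj_inv2pi; congr (_ * _).
have iw := cintegrable_conj (cintegrable_wave x ru).
have := cint_comp1 (transports_reflect n) iw.
rewrite -cint_conj; last exact: cintegrable_wave.
move=> <-; apply: eq_cint => k.
rewrite /comp fourier1_conj // conjcM conj_expi dotZl; congr (_ * expi _); ring.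
Qed.

Lemma fourier_rep1Z (c : C) (u : V -> C) :
  fourier_rep1 u -> fourier_rep1 (fun x => c * u x).
Proof.
move=> ru; have [iu iU _] := ru.
have E k : c * fourier1 u k = fourier1 (fun x => c * u x) k.
  rewrite -cintZ; last exact: cintegrable_fourier_kernel.
  by apply: eq_cint => x; rewrite mulrCA.
split; [exact: cintegrableZ|exact: eq_cintegrable E (cintegrableZ _ _)|].
move=> x; rewrite -(fourier_rep1E x ru) mulrCA; congr (_ * _).
rewrite -cintZ; last exact: cintegrable_wave.
by apply: eq_cint => k; rewrite -E mulrA.
Qed.

(** Conjugation negates both wave vectors and reverses the two factors; this substitution
    compensates for both. *)
Lemma transports_swap_reflect :
  transports leb2 leb2 (fun q : W => (vscale (-1) q.2, vscale (-1) q.1)) 1.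
Proof.
have := transports_comp (transports_swap (leb n) (leb n))
  (transports_prod (transports_reflect (R := R) n) (transports_reflect n)).
by rewrite !mul1r.
Qed.

Definition vreflect2 (q : W) : W := (vscale (-1) q.1, vscale (-1) q.2).

Lemma transports_reflect2 : transports leb2 leb2 vreflect2 1.
Proof.
have := transports_prod (transports_reflect (R := R) n) (transports_reflect n).
by rewrite !mul1r.
Qed.

Lemma transports_swap_reflect2 :
  transports (sfprod leb2 leb2) (sfprod leb2 leb2)
    (fun q => (vreflect2 q.2, vreflect2 q.1)) 1.
Proof.
have := transports_comp (transports_swap leb2 leb2)
  (transports_prod transports_reflect2 transports_reflect2).
by rewrite !mul1r.
Qed.

Section conj_wigner.
Variables (u v : V -> C).
Hypotheses (ru : fourier_rep1 u) (rv : fourier_rep1 v).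
Let iu : cintegrable leb1 u. Proof. by case: ru. Qed.
Let iv : cintegrable leb1 v. Proof. by case: rv. Qed.
Let iU : cintegrable leb1 (fourier1 u). Proof. by case: ru. Qed.
Let iV : cintegrable leb1 (fourier1 v). Proof. by case: rv. Qed.

(** The middle wave becomes [e^(- i p.w)], hence the sign of [w]. Swapping and negating the outer
    wave vectors leaves a theta term of the wrong sign, which antisymmetry corrects. *)
Lemma conj_star_exp w z : (star_exp hbar theta u w v z)^*%C =
  star_exp hbar theta (fun x => (v x)^*%C) (vscale (-1) w)
    (fun x => (u x)^*%C) z.
Proof.
rewrite !star_expE conjcM conj_inv2pi; congr (_ * _).
rewrite -cint_conj; last first.
  by apply: cintegrable_phase; [measurability|exact: cintegrable_tensor].
have iF : cintegrable leb2 (fun q => (fourier1 u q.1 * fourier1 v q.2 *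
    expi (dot w z.2 + dot q.2 z.1 + hbar / 2 * dot q.2 w +
      (dot q.1 z.1 - hbar / 2 * dot q.1 w -
        1 / 2 * dot q.1 (vlin theta q.2))))^*%C).
  apply: cintegrable_conj.
  by apply: cintegrable_phase; [measurability|exact: cintegrable_tensor].
rewrite -(cint_comp1 transports_swap_reflect iF).
apply: eq_cint => q.
rewrite /comp !conjcM conj_expi !fourier1_conj // vlinZ.
merge_phases; rewrite !dotE (dot_vlinC q.2 q.1 skew); ring.
Qed.

Lemma conj_wigner z : (wigner u v z)^*%C =
  wigner (fun x => (v x)^*%C) (fun x => (u x)^*%C) z.
Proof.
rewrite /wigner conjcM conj_inv2pi; congr (_ * _).
have iS := cintegrable_star_exp ru iV z.
rewrite -cint_conj //.
have := cint_comp1 (transports_reflect n) (cintegrable_conj iS).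
move=> <-; apply: eq_cint => w.
by rewrite /comp conj_star_exp vscaleN1K.
Qed.

End conj_wigner.

Lemma fourier2_conj (A : W -> C) q : cintegrable leb2 A ->
  fourier2 (fun x => (A x)^*%C) q = (fourier2 A (vreflect2 q))^*%C.
Proof.
move=> iA; rewrite -cint_conj.
  apply: eq_cint => x; rewrite conjcM conj_expi !dotZl; congr (expi _ * _); ring.
apply: (@eq_cintegrable _ _ _ _ (fun z => A z *
    expi (- dot (vreflect2 q).1 z.1 - dot (vreflect2 q).2 z.2))).
  by move=> x; rewrite mulrC.
by apply: cintegrable_phase => //; measurability.
Qed.

Lemma conj_star (A B : W -> C) z :
  cintegrable leb2 A -> cintegrable leb2 B ->
  cintegrable leb2 (fourier2 A) -> cintegrable leb2 (fourier2 B) ->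
  (star hbar theta A B z)^*%C =
  star hbar theta (fun x => (B x)^*%C) (fun x => (A x)^*%C) z.
Proof.
move=> iA iB iFA iFB; rewrite !starE // conjcM conj_inv2pi; congr (_ * _).
have iF := cintegrable_star z iFA iFB.
rewrite -cint_conj //.
have := cint_comp1 transports_swap_reflect2 (cintegrable_conj iF).
move=> <-.
apply: eq_cint => q.
rewrite /comp !conjcM conj_expi !fourier2_conj // /star_phase /star_arg /=.
merge_phases; rewrite vlinZ !dotE (dot_vlinC q.1.1 q.2.1 skew).
rewrite (dotC q.1.1 q.2.2) (dotC q.1.2 q.2.1); ring.
Qed.

(** * The Weyl operator on [phi] becomes left star multiplication by [h] *)

Section intertwining.
Variables (h : W -> C) (phi v : V -> C).
Hypotheses (ih : cintegrable leb2 (fourier2 h)).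
Hypotheses (rphi : fourier_rep1 phi) (iv : cintegrable leb1 (fourier1 v)).

Let iphi : cintegrable leb1 phi. Proof. by case: rphi. Qed.

(** The integrand of the Wigner transform after expanding the Weyl operator: [q.1] is [(w, k')] and
    [q.2] is [(k, l)]. *)
Let K z (q : W * W) : C :=
  fourier1 v q.1.2 *
    expi (dot q.1.1 z.2 + dot q.1.2 z.1 + hbar / 2 * dot q.1.2 q.1.1) *
  weyl_kernel h phi (wigner_arg z.1 q.1.1 q.1.2) q.2.

Let iK z : cintegrable (sfprod leb2 leb2) (K z).
Proof.
pose s (r : V * W) := vadd (vadd z.1 (vscale (- (1 / 2)) (vlin theta r.1)))
  (weyl_shift r.2).
have ms : measurable_fun setT s by rewrite /s /weyl_shift; measurability.
have a0 : - (hbar / 2) != 0 by rewrite oppr_eq0 mulf_neq0 // gt_eqF.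
have := cintegrable_translates2 a0 ms iphi iv ih.
move=> /(cintegrable_phase (t := fun q : W * W =>
  dot q.1.1 z.2 + dot q.1.2 z.1 + hbar / 2 * dot q.1.2 q.1.1 +
  (dot q.2.1 (wigner_arg z.1 q.1.1 q.1.2) +
   hbar / 2 * dot q.2.2 q.2.1))) I.
apply: eq_cintegrable (I _); last by rewrite /wigner_arg; measurability.
move=> q; rewrite /K /weyl_kernel.
rewrite (_ : vadd _ (s _) = vadd (wigner_arg z.1 q.1.1 q.1.2)
  (weyl_shift q.2)); first by rewrite expiD; ring.
by apply: eq_from_tnth => i; rewrite !vaddE; ring.
Qed.

Lemma transports_shift1 (b : V) :
  transports leb2 leb2 (fun q : W => (vadd q.1 b, q.2)) 1.
Proof.
apply: transports_shear => //; first by measurability.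
by move=> y; exact: transports_shift.
Qed.

Lemma wigner_weyl_star z : fourier_rep2 (wigner phi v) ->
  wigner (weyl_star hbar theta h phi) v z =
  star hbar theta h (wigner phi v) z.
Proof.
move=> rf; have rW := fourier_rep1_weyl_star ih rphi.
rewrite (star_shift z ih rf) (wignerE rW iv z).
congr (_ * _).
transitivity (inv2pi (2 * n)%N *
    cint leb2 (fun q => cint leb2 (fun xi => K z (q, xi)))).
  rewrite -cintZ; last exact: (cintegrable_cint1 (iK z)).
  apply: eq_cint => q; rewrite /wigner_kernel (weyl_starE ih rphi) mulrCA.
  by congr (_ * _); rewrite -cintZ //; exact: cintegrable_weyl_kernel.
rewrite -(cint_prod1 (iK z)) (cint_prod2 (iK z)).
rewrite -cintZ; last exact: (cintegrable_cint2 (iK z)).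
apply: eq_cint => xi; rewrite (wignerE rphi iv) mulrCA; congr (_ * _).
have iw := cintegrable_wigner (star_arg z xi) iphi iv.
(* Replacing [w] by [w - l] adds [hbar l / 2] to the argument of [phi]; with the [hbar l / 2] of
   [star_arg] this makes the full [hbar l] of [weyl_shift]. *)
have tT := transports_shift1 (vscale (-1) xi.2).
rewrite -(cint_comp1 tT iw) -cintZ; last exact: (cintegrable_comp tT iw).
apply: eq_cint => q; rewrite /comp /K /wigner_kernel /weyl_kernel.
rewrite (_ : vadd _ (weyl_shift _) = wigner_arg
  (star_arg z xi).1 (vadd q.1 (vscale (-1) xi.2)) q.2); last first.
  by apply: eq_from_tnth => i; rewrite !(vaddE, vscaleE); field.
(* Pairing [w - l] with the shifted momentum [p - hbar k / 2] yields the Weyl-ordering phase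
   [hbar k.l / 2], and its [- l.p] cancels the [l.p] of the wave of [h]. *)
merge_phases; rewrite /wigner_arg /star_arg /= !dotE.
rewrite (dotC xi.1 q.1) (dot_vlinC q.2 xi.1 skew); ring.
Qed.

End intertwining.

End star_product_theory.

(** * The variation of the phase-space distribution *)

Theorem theorem2 (R : realType) (n : nat) (hbar : R) (theta : 'M[R]_n)
    (phi : Rn R n -> R[i]) (h : Rn R n * Rn R n -> R)
    (f : Rn R n * Rn R n -> R[i]) (dphi : Rn R n -> R[i]) :
  (1 <= n)%N -> 0 < hbar -> theta^T = - theta ->
  f = fdist hbar theta phi ->
  dphi = (fun x => 'i%C * weyl_star hbar theta (fun z => (h z)%:C%C) phi x) ->
  (* the Fourier representations of phi, h and f are meaningful *)
  fourier_rep1 phi -> fourier_rep2 (fun z => (h z)%:C%C) -> fourier_rep2 f ->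
  forall z, fdist_var hbar theta phi dphi z =
    'i%C * (star hbar theta (fun z => (h z)%:C%C) f z -
            star hbar theta f (fun z => (h z)%:C%C) z).
Proof.
move=> _ hbar0 skew ->; set hC := fun z => (h z)%:C%C; move=> ->.
set W := weyl_star hbar theta hC phi; move=> rphi [ih iH _] rf z; have [if_ iF _] := rf.
set phi' := fun x => (phi x)^*%C.
have rphi' : fourier_rep1 phi' := fourier_rep1_conj rphi.
have [_ iPhi' _] := rphi'.
have phiK : (fun x => (phi' x)^*%C) = phi by apply/funext => x; exact: conjcK.
have rW : fourier_rep1 W := fourier_rep1_weyl_star hbar skew iH rphi.
have [iW _ _] := rW.
pose dphi' x := 'i%C * W x.
have rdphi : fourier_rep1 dphi' := fourier_rep1Z _ rW.
have [_ idphi' _] := fourier_rep1_conj rdphi.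
have fE : fdist hbar theta phi = wigner hbar theta phi phi' by [].
move: rf if_ iF; rewrite -/dphi' fE => rf if_ iF.
(* [f] is real: exchanging the slots and conjugating each fixes the pair [phi], [phi']. *)
have fR : (fun y => (wigner hbar theta phi phi' y)^*%C) =
    wigner hbar theta phi phi'.
  apply/funext => y; have := conj_wigner hbar0 skew rphi rphi' y.
  by rewrite phiK.
have hR : (fun y => (hC y)^*%C) = hC by apply/funext => y; exact: conjc_real.
have E1 : wigner hbar theta dphi' phi' z =
    'i%C * star hbar theta hC (wigner hbar theta phi phi') z.
  rewrite -(wigner_weyl_star hbar0 skew iH rphi iPhi' z rf).
  rewrite (wignerE theta hbar0 rdphi iPhi') (wignerE theta hbar0 rW iPhi').
  rewrite mulrCA; congr (_ * _).
  rewrite -(cintZ _ (cintegrable_wigner theta hbar0 z iW iPhi')).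
  by apply: eq_cint => q; rewrite /wigner_kernel /dphi' mulrCA.
(* Conjugating [E1] reverses [h * f], fixes both real factors and turns ['i] into [- 'i]. *)
have E2 : wigner hbar theta phi (fun x => (dphi' x)^*%C) z =
    - ('i%C * star hbar theta (wigner hbar theta phi phi') hC z).
  have := conj_wigner hbar0 skew rdphi rphi' z.
  rewrite phiK E1 conjcM (conj_star hbar skew z ih if_ iH iF) fR hR => <-.
  rewrite -mulNr; congr (_ * _).
  by apply/eqP; rewrite eq_complex /= oppr0 !eqxx.
(* Splitting the integral over [w] requires each of the two products to be integrable in [w]
   separately. *)
have E : fdist_var hbar theta phi dphi' z = wigner hbar theta dphi' phi' z +
    wigner hbar theta phi (fun x => (dphi' x)^*%C) z.
  by rewrite /wigner -mulrDr -(cintD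
    (cintegrable_star_exp theta hbar0 rdphi iPhi' z)
    (cintegrable_star_exp theta hbar0 rphi idphi' z)).
by rewrite E E1 E2 mulrBr.
Qed.
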